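(* Let $q=2^h$ with $h\geq1$ odd, and let \[U:=\{(x,\,y,\,x^{q^2}+y^{q},\,x^{q}+y^{q^3}) : x,y\in\mathbb{F}_{q^6},\ \mathrm{Tr}_{q^6/q^2}(x)=\mathrm{Tr}_{q^6/q^2}(y)=0\}\subseteq\mathbb{F}_{q^6}^4.\] Let $W$ be a $2$-dimensional $\mathbb{F}_{q^6}$-subspace of $\mathbb{F}_{q^6}^4$ which is not fixed by the map $x\mapsto x^{q^2}$ (applied coordinatewise) and which is contained in a $3$-dimensional $\mathbb{F}_{q^6}$-subspace $M$ fixed by $x\mapsto x^{q^2}$. Then $\dim_{\mathbb{F}_q}(W\cap U)\leq 2$.
   Context: $\mathrm{Tr}_{q^6/q^2}(x)=x+x^{q^2}+x^{q^4}$. A subspace $M$ is fixed by $x\mapsto x^{q^2}$ if $\{(m_1^{q^2},\dots,m_4^{q^2}):(m_1,\dots,m_4)\in M\}=M$. *)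

(* Defs.v *)
From HB Require Import structures.
From mathcomp Require Import all_boot all_algebra all_fingroup all_field.

Set Implicit Arguments.
Unset Strict Implicit.
Unset Printing Implicit Defensive.

Import GRing.Theory.
Local Open Scope ring_scope.

(* Restriction of scalars: an L-space V viewed as an F-space, for L / F a
   finite extension (the analogue of baseFieldType for vector spaces). *)
Section BaseVect.

Variables (F : fieldType) (L : fieldExtType F) (V : vectType L).

Definition baseVectType : Type := V.
Local Notation V0 := baseVectType.

HB.instance Definition _ := GRing.Zmodule.on V0.

Definition baseVect_scale (a : F) (u : V0) : V0 := (a%:A : L) *: (u : V).

Fact baseVect_scaleA a b u :
  baseVect_scale a (baseVect_scale b u) = baseVect_scale (a * b) u.
Proof. by rewrite /baseVect_scale scalerA -(rmorphM (in_alg L)). Qed.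

Fact baseVect_scale1 u : baseVect_scale 1 u = u.
Proof. by rewrite /baseVect_scale !scale1r. Qed.

Fact baseVect_scaleDr a u v :
  baseVect_scale a (u + v) = baseVect_scale a u + baseVect_scale a v.
Proof. exact: scalerDr. Qed.

Fact baseVect_scaleDl v a b :
  baseVect_scale (a + b) v = baseVect_scale a v + baseVect_scale b v.
Proof. by rewrite /baseVect_scale -scalerDl -scalerDl. Qed.

HB.instance Definition _ := GRing.Zmodule_isLmodule.Build F V0
  baseVect_scaleA baseVect_scale1 baseVect_scaleDr baseVect_scaleDl.

Lemma baseVect_scaleE (a : F) (u : V) :
  a *: (u : V0) = (a%:A : L) *: u :> V.
Proof. by []. Qed.

Let n := \dim {:L}.
Let bL : n.-tuple L := vbasis {:L}.
Let coordL (x : L) := coord_vbasis (memvf x).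

Fact baseVect_vectMixin : Lmodule_hasFinDim F V0.
Proof.
pose bV := vbasis {:V}; set m := \dim {:V} in bV.
pose v2r (x : V0) := mxvec (\matrix_(i, j) coord bL j (coord bV i x)).
have v2r_lin: linear v2r.
  move=> a x y; rewrite -linearP; congr mxvec; apply/matrixP=> i j.
  by rewrite !mxE linearP /= mulr_algl linearP.
pose r2v r : V0 := \sum_(i < m) (\sum_(j < n) vec_mx r i j *: bL`_j) *: bV`_i.
have v2rK: cancel v2r r2v.
  move=> x; transitivity (\sum_(i < m) coord bV i x *: bV`_i); last first.
    by rewrite -coord_vbasis ?memvf.
  apply: eq_bigr => i _; rewrite mxvecK; congr (_ *: _ : V).
  by rewrite (coordL (coord bV i x)); apply: eq_bigr => j _; rewrite mxE.
exists (m * n)%N, v2r => //; exists r2v => // r.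
apply: (canLR vec_mxK); apply/matrixP=> i j; rewrite mxE.
by rewrite !coord_sum_free ?(basis_free (vbasisP _)).
Qed.

HB.instance Definition _ := baseVect_vectMixin.

End BaseVect.

Section SpanPred.

Variables (F : finFieldType) (V : vectType F).

(* F being finite, V has finitely many vectors (finvect_type V is V itself);
   this is the subspace with carrier P as soon as P is closed. *)
Definition span_pred (P : pred V) : {vspace V} :=
  <<[seq v : V <- enum (finvect_type V) | P v]>>%VS.

Lemma mem_span_pred (P : pred V) (v : V) :
  submod_closed P -> (v \in span_pred P) = P v.
Proof.
move=> [P0 PD]; apply/idP/idP; last first.
  by move=> Pv; apply: memv_span; rewrite mem_filter Pv (@mem_enum (finvect_type V)).
rewrite /span_pred; set X := filter _ _ => /(@coord_span _ _ _ (in_tuple X)) ->.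
apply: (big_ind P) => [//|x y Px Py|i _].
  by rewrite -[x]scale1r; apply: PD.
have: X`_i \in X by apply: mem_nth; rewrite ltn_ord.
by rewrite mem_filter => /andP[PX _]; rewrite -[_ *: _]addr0; apply: PD.
Qed.

End SpanPred.

Section Construction.

Variables (Fq : finFieldType) (L : fieldExtType Fq).
Local Notation q := #|Fq|.

Definition restrVspace (V : vectType L) (W : {vspace V}) :
    {vspace baseVectType V} :=
  span_pred [pred v : baseVectType V | (v : V) \in W].

Lemma mem_restrVspace (V : vectType L) (W : {vspace V}) (v : V) :
  ((v : baseVectType V) \in restrVspace W) = (v \in W).
Proof.
rewrite mem_span_pred //; split=> [|a u w]; first exact: (mem0v W).
by move=> uW wW; apply: (@memvD _ _ W) => //; apply: (@memvZ _ _ W).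
Qed.

Definition Tr (x : L) : L := x + x ^+ (q ^ 2) + x ^+ (q ^ 4).

Definition Uvec (x y : L) : 'rV[L]_4 :=
  \row_(j < 4) [:: x; y; x ^+ (q ^ 2) + y ^+ q; x ^+ q + y ^+ (q ^ 3)]`_j.

Definition Upred (v : 'rV[L]_4) : bool :=
  [exists x : finvect_type L, exists y : finvect_type L,
    [&& Tr x == 0, Tr y == 0 & v == Uvec x y]].

Definition U : {vspace baseVectType 'rV[L]_4} :=
  span_pred [pred v : baseVectType 'rV[L]_4 | Upred v].

Lemma UpredP (v : 'rV[L]_4) :
  reflect (exists x y : L, [/\ Tr x = 0, Tr y = 0 & v = Uvec x y]) (Upred v).
Proof.
apply: (iffP existsP) => [[x /existsP[y /and3P[/eqP ? /eqP ? /eqP ?]]]|].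
  by exists x, y.
move=> [x [y [Tx Ty ->]]]; exists x; apply/existsP; exists y.
by rewrite Tx Ty !eqxx.
Qed.

Lemma expqP k (a : Fq) (x y : L) :
  (a *: x + y) ^+ (q ^ k) = a *: x ^+ (q ^ k) + y ^+ (q ^ k).
Proof.
have [p p_pr pF] := finPcharP Fq.
have pL : p \in [pchar L] by rewrite pchar_lalg.
rewrite exprDn_pchar ?exprZn; last first.
  rewrite (eq_pnat _ (pcharf_eq pL)) pnatX.
  by rewrite (@card_pprimeChar p Fq pF) pnatX pnat_id.
by congr (_ *: _ + _); elim: k => // k IH; rewrite expnSr exprM IH expf_card.
Qed.

Lemma TrP (a : Fq) (x y : L) : Tr (a *: x + y) = a *: Tr x + Tr y.
Proof. by rewrite /Tr !expqP !scalerDr [RHS]addrACA; congr (_ + _); rewrite addrACA. Qed.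

Lemma UvecP (a : Fq) (x y x' y' : L) :
  Uvec (a *: x + x') (a *: y + y') = a%:A *: Uvec x y + Uvec x' y'.
Proof.
have e1 (z w : L) : (a *: z + w) ^+ q = a *: z ^+ q + w ^+ q.
  exact: (expqP 1).
apply/rowP => j; rewrite !mxE !expqP !e1 mulr_algl.
by case: j => [[|[|[|[|//]]]] ?] //=; rewrite scalerDr addrACA.
Qed.

Lemma mem_U (v : 'rV[L]_4) :
  (v : baseVectType 'rV[L]_4) \in U <->
  exists x y : L, [/\ Tr x = 0, Tr y = 0 & v = Uvec x y].
Proof.
rewrite mem_span_pred; first by split=> /UpredP.
have q0 k : 0 ^+ (q ^ k) = 0 :> L.
  by rewrite expr0n expn_eq0 -leqn0 leqNgt ltnW ?finNzRing_gt1.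
split=> [|a u w].
  apply/UpredP; exists 0, 0; rewrite /Tr !q0 !addr0; split=> //.
  apply/rowP => j; rewrite !mxE.
  by case: j => [[|[|[|[|//]]]] ?] //=; rewrite ?(q0 1) ?q0 addr0.
move=> /UpredP[x [y [Tx Ty ->]]] /UpredP[x' [y' [Tx' Ty' ->]]].
apply/UpredP; exists (a *: x + x'), (a *: y + y').
by rewrite !TrP Tx Ty Tx' Ty' !scaler0 !addr0 UvecP.
Qed.

Definition frob2 (n : nat) (v : 'rV[L]_n) : 'rV[L]_n :=
  map_mx (fun x => x ^+ (q ^ 2)) v.

Definition frob2_fixed (n : nat) (M : {vspace 'rV[L]_n}) : Prop :=
  forall v : 'rV[L]_n, (exists2 m, m \in M & v = frob2 m) <-> v \in M.

End Construction.

Arguments U {Fq} L.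

(* Main.v *)
Require Import Defs.
From HB Require Import structures.
From mathcomp Require Import all_boot all_algebra all_fingroup all_solvable.
From mathcomp Require Import all_field ring.

(** Write [sigma x = x ^ q ^ 2] and [tau x = x ^ q], and let [w] be a primitive
    cube root of unity; since [h] is odd, [tau w = w ^ 2].  Every [u] in [U] has
    [u + sigma u + sigma (sigma u) = 0], so it is the sum of
    [z = w ^ 2 u + sigma u], with [sigma z = w z], and [w u + sigma u], and the
    latter turns out to be [tau z * Q] for a matrix [Q] over GF(4).  The square of
    this semilinear map is governed by [R = (tau Q) Q], which is annihilated by
    [1 + X + X^2 + X^3 + X^4]; as [h] is odd this polynomial has no root in GF(q),
    so neither [R] nor its transpose has an eigenvalue in GF(q).  Hence no nonzero
    [u] in [U] spans a sigma-fixed point, and (dually) [U] meets every sigma-fixed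
    hyperplane [M] in GF(q)-dimension at most 4.  If [S], the intersection of [W]
    and [U], had dimension at least 3, then [S] and [sigma S], both contained in
    the intersection of [M] and [U], would meet: some nonzero [u] in [U] would have
    [u] and [sigma u] in [W].  These two vectors span a sigma-fixed plane, so [W]
    itself would be fixed. *)

Set Implicit Arguments.
Unset Strict Implicit.
Unset Printing Implicit Defensive.

Import GRing.Theory.
Local Open Scope ring_scope.

(** * Cube roots of unity and the matrix Q over GF(4) *)

Lemma finField_cube_root (F : finFieldType) :
  (3 %| #|F|.-1)%N -> exists w : F, w ^+ 2 + w + 1 = 0.
Proof.
rewrite -card_finField_unit => /(Cauchy (isT : prime 3))[x _ ox].
exists (val x); apply/eqP.
have /eqP: (val x - 1) * (val x ^+ 2 + val x + 1) = 0.
  have x3 : val x ^+ 3 = 1 by rewrite -FinRing.val_unitX -ox expg_order.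
  have -> : (val x - 1) * (val x ^+ 2 + val x + 1) = val x ^+ 3 - 1 by ring.
  by rewrite x3 subrr.
rewrite mulf_eq0 => /orP[|//]; rewrite subr_eq0 => /eqP x1.
by have := order_gt1 x; rewrite ox -val_eqE /= x1 eqxx.
Qed.

Section F4Matrix.

Variable L : fieldType.
Hypothesis char2 : (1 + 1 : L) = 0.

Lemma addrr2 (x : L) : x + x = 0.
Proof. by rewrite -[x]mul1r -mulrDl char2 mul0r. Qed.

Lemma oppr2 (x : L) : - x = x.
Proof. by apply/eqP; rewrite eq_sym -addr_eq0 addrr2. Qed.

(* The relation between the two eigenparts of an element of U, written in terms
   of a primitive cube root of unity w; see U_eigenparts. *)
Definition Umx (w : L) : 'M[L]_4 :=
  \matrix_(i < 4, j < 4)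
    (nth [::] [:: [:: w ^+ 2; 1; w; 1]; [:: 0; 0; 1; w ^+ 2];
                  [:: 1; w; w ^+ 2; 0]; [:: w; 0; 1; 0]] i)`_j.

(** This is [R = (tau Q) Q]: as [tau w = w ^+ 2], the conjugate of [Umx w] is [Umx (w ^+ 2)]. *)
Definition UUmx (w : L) : 'M[L]_4 := Umx (w ^+ 2) *m Umx w.

(* 1 + A + A^2 + A^3 + A^4, with a single product left once A^2 is known. *)
Definition Phi5 (A : 'M[L]_4) : 'M[L]_4 :=
  A *m A *m (A *m A + A + 1%:M) + (A + 1%:M).

Lemma map_Umx (f : {rmorphism L -> L}) w : map_mx f (Umx w) = Umx (f w).
Proof.
apply/matrixP => i j; rewrite !mxE.
by case: i => [[|[|[|[|//]]]] ?] /=; case: j => [[|[|[|[|//]]]] ?] /=;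
  rewrite ?rmorph1 ?rmorph0 ?rmorphXn.
Qed.

Lemma Phi5_UUmx w : w ^+ 2 + w + 1 = 0 -> Phi5 (UUmx w) = 0.
Proof.
move=> ww.
have w2E : w ^+ 2 = 1 + w.
  by apply/eqP; rewrite -subr_eq0 oppr2 [1 + w]addrC addrA; apply/eqP.
set v := w ^+ 2.
have wwE : w * w = v by [].
have wvE : w * v = 1.
  by rewrite /v w2E mulrDr mulr1 wwE /v w2E addrCA addrr2 addr0.
have vwE : v * w = 1 by rewrite mulrC.
have vvE : v * v = w by rewrite {2}/v expr2 mulrA vwE mul1r.
have v2E : v ^+ 2 = w by [].
have a1 : 1 + w = v by [].
have a2 : w + 1 = v by rewrite addrC.
have a3 : 1 + v = w by rewrite /v w2E addrA char2 add0r.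
have a4 : v + 1 = w by rewrite addrC.
have a5 : w + v = 1 by rewrite -a1 addrCA addrr2 addr0.
have a6 : v + w = 1 by rewrite addrC.
(* The addition and multiplication tables of GF(4) = {0, 1, w, v}; rewriting with them evaluates
   every matrix entry. *)
have E := (wwE, wvE, vwE, vvE, mul0r, mulr0, mul1r, mulr1, char2, addrr2 w,
  addrr2 v, a1, a2, a3, a4, a5, a6, addr0, add0r).
have UU : UUmx w = \matrix_(i < 4, j < 4)
    (nth [::] [:: [:: 0; v; 1; 1]; [:: w; w; 1; 0];
                  [:: 1; w; 0; v]; [:: v; 1; w; v]] i)`_j.
  apply/matrixP => i j; rewrite !mxE !big_ord_recl big_ord0 !mxE /=.
  rewrite v2E -/v.
  by case: i => [[|[|[|[|//]]]] ?] /=; case: j => [[|[|[|[|//]]]] ?] /=;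
    rewrite !E.
have UU2 : UUmx w *m UUmx w = \matrix_(i < 4, j < 4)
    (nth [::] [:: [:: v; w; 1; 0]; [:: w; 0; 0; 1];
                  [:: 1; v; w; v]; [:: w; 0; v; 0]] i)`_j.
  rewrite UU; apply/matrixP => i j.
  rewrite !mxE !big_ord_recl big_ord0 !mxE /=.
  by case: i => [[|[|[|[|//]]]] ?] /=; case: j => [[|[|[|[|//]]]] ?] /=;
    rewrite !E.
rewrite /Phi5 UU2 UU; apply/matrixP => i j.
rewrite !mxE !big_ord_recl big_ord0 !mxE /=.
by case: i => [[|[|[|[|//]]]] ?] /=; case: j => [[|[|[|[|//]]]] ?] /=;
  rewrite !E.
Qed.

Lemma Phi5_tr A : Phi5 A = 0 -> Phi5 A^T = 0.
Proof.
move=> A0; suff <- : (Phi5 A)^T = Phi5 A^T by rewrite A0 trmx0.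
have trD (B C : 'M[L]_4) : (B + C)^T = B^T + C^T := raddfD _ B C.
rewrite /Phi5 !(trD, trmx_mul, trmx1).
by rewrite !mulmxDr !mulmxDl !mulmxA !mulmx1 !mul1mx.
Qed.

Lemma Phi5_eigen A (v : 'rV[L]_4) k : Phi5 A = 0 -> v *m A = k *: v -> v != 0 ->
  k ^+ 4 + k ^+ 3 + k ^+ 2 + k + 1 = 0.
Proof.
move=> A0 vA v0; apply/eqP.
have : (k ^+ 4 + k ^+ 3 + k ^+ 2 + k + 1) *: v = 0.
  transitivity (v *m Phi5 A); last by rewrite A0 mulmx0.
  rewrite /Phi5 !mulmxDr !mulmxA !mulmx1 !(vA, =^~ scalemxAl).
  by apply/rowP => i; rewrite !mxE; ring.
by move/eqP; rewrite scaler_eq0 (negPf v0) orbF.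
Qed.

(** A root is a fifth root of unity. For odd [h], [2 ^ h] is 2 or 3 modulo 5, so [k ^+ (2 ^ h) = k]
    forces [k ^+ 2 = 1], hence [k = 1]; but in characteristic 2 the five terms then sum to 1. *)
Lemma Phi5_no_root_Fq h (k : L) : odd h -> k ^+ (2 ^ h) = k ->
  k ^+ 4 + k ^+ 3 + k ^+ 2 + k + 1 != 0.
Proof.
move=> ho kq; apply/eqP => k0.
have k5 : k ^+ 5 = 1.
  apply/eqP; rewrite -subr_eq0; apply/eqP.
  by transitivity ((k - 1) * (k ^+ 4 + k ^+ 3 + k ^+ 2 + k + 1));
    [ring | rewrite k0 mulr0].
have knz : k != 0.
  by apply/eqP => kz; move: k5; rewrite kz expr0n => /esym/eqP; rewrite oner_eq0.
have k2 : k ^+ 2 = 1.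
  have /orP[/eqP hm|/eqP hm] : (2 ^ h %% 5 == 2)%N || (2 ^ h %% 5 == 3)%N.
    (* [2 ^ h] is twice a power of 4, and a power of 4 is 1 or 4 modulo 5. *)
    rewrite -(odd_double_half h) ho add1n expnS -muln2 mulnC expnM -modnMml.
    have /orP[] : ((2 ^ h./2) ^ 2 %% 5 == 1)%N || ((2 ^ h./2) ^ 2 %% 5 == 4)%N.
      elim: (h./2) => // n; rewrite -!expnM mulSn expnD -modnMmr.
      by case/orP => /eqP ->.
      by move=> /eqP ->.
    by move=> /eqP ->.
  - move: kq; rewrite (divn_eq (2 ^ h) 5) hm exprD mulnC exprM k5 expr1n mul1r.
    by rewrite expr2 => /(canRL (mulfK knz)); rewrite divff // => ->; rewrite mulr1.
  move: kq; rewrite (divn_eq (2 ^ h) 5) hm exprD mulnC exprM k5 expr1n mul1r.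
  by rewrite exprSr => /(canRL (mulfK knz)); rewrite divff.
have k1 : k = 1.
  by move: k5; rewrite (exprD k 2 3) k2 (exprD k 1 2) k2 mul1r mulr1.
move/eqP: k0; rewrite k1 !expr1n char2 add0r char2 add0r.
by rewrite oner_eq0.
Qed.

End F4Matrix.

(** * Powers of the Frobenius map *)

Section Frobenius.

Variables (Fq : finFieldType) (L : fieldExtType Fq).
Local Notation q := #|Fq|.

(** Indexed by the exponent of [q], so that composition adds indices; [frob 1] is tau and [frob 2]
    is sigma. *)
Definition frob (k : nat) (x : L) : L := x ^+ (q ^ k).

Fact frob_zmod_morphism k : zmod_morphism (frob k).
Proof.
by move=> x y; rewrite /frob -![_ - _]addrC -!scaleN1r -expqP.
Qed.
HB.instance Definition _ k :=
  GRing.isZmodMorphism.Build L L (frob k) (frob_zmod_morphism k).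

Fact frob_monoid_morphism k : monoid_morphism (frob k).
Proof. by split=> [|x y]; rewrite /frob ?expr1n ?exprMn. Qed.
HB.instance Definition _ k :=
  GRing.isMonoidMorphism.Build L L (frob k) (frob_monoid_morphism k).

Lemma frobZ k (a : Fq) x : frob k (a *: x) = a *: frob k x.
Proof. by rewrite -[a *: x]addr0 /frob expqP -/(frob k 0) rmorph0 addr0. Qed.

Lemma frob_comp j k x : frob j (frob k x) = frob (j + k) x.
Proof. by rewrite /frob -exprM addnC expnD. Qed.

Lemma card_finvect : #|finvect_type L| = (q ^ \dim {:L})%N.
Proof.
by rewrite -(@card_vspacef Fq (finvect_type L) (Vector.class (finvect_type L)))
           card_vspace.
Qed.

Lemma frob_dim x : frob (\dim {:L}) x = x.
Proof. by rewrite /frob -card_finvect (expf_card (x : finvect_type L)). Qed.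

Lemma map_frob_comp n j k (v : 'rV[L]_n) :
  map_mx (frob j) (map_mx (frob k) v) = map_mx (frob (j + k)) v.
Proof. by apply/rowP => i; rewrite !mxE frob_comp. Qed.

(** The elements of [E] are roots of [X^(q^k) - c X], a polynomial with at most [q^k] roots, while
    [E] has [q^(dim E)] elements. *)
Lemma dim_frob_eigen k (c : L) (E : {vspace L}) :
  (0 < k)%N -> (forall x, x \in E -> frob k x = c * x) -> (\dim E <= k)%N.
Proof.
move=> k0 Ec; have q1 := finNzRing_gt1 Fq.
rewrite -(leq_exp2l _ _ q1) -(@card_vspace Fq (finvect_type L)).
pose p : {poly L} := 'X^(q ^ k) - c *: 'X.
have sp : size p = (q ^ k).+1.
  rewrite size_polyDl size_polyXn // size_polyN.
  apply: leq_ltn_trans (size_scale_leq _ _) _.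
  by rewrite size_polyX ltnS (leq_trans q1) // -{1}(expn1 q) leq_exp2l.
have p0 : p != 0 by rewrite -size_poly_eq0 sp.
rewrite cardE -ltnS -sp; apply: (@max_poly_roots L p _ p0).
  apply/allP => x; rewrite (@mem_enum (finvect_type L)) => xE.
  by rewrite rootE !hornerE -/(frob k x) Ec ?subrr.
exact: enum_uniq.
Qed.

End Frobenius.

(** * Linear equations in coordinates *)

Section Coordinates.

Variables (L : fieldType) (n : nat).

Definition dot (a z : 'rV[L]_n) : L := (a *m z^T) 0 0.

Lemma dotE a z : dot a z = \sum_i a 0 i * z 0 i.
Proof. by rewrite /dot mxE; apply: eq_bigr => i _; rewrite mxE. Qed.

Lemma dotC a z : dot a z = dot z a.
Proof. by rewrite !dotE; apply: eq_bigr => i _; rewrite mulrC. Qed.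

Lemma dotDl a b z : dot (a + b) z = dot a z + dot b z.
Proof. by rewrite /dot mulmxDl mxE. Qed.

Lemma dotZl c a z : dot (c *: a) z = c * dot a z.
Proof. by rewrite /dot -scalemxAl mxE. Qed.

Lemma dot_mulmx a (A : 'M_n) z : dot (a *m A) z = dot a (z *m A^T).
Proof. by rewrite /dot trmx_mul trmxK mulmxA. Qed.

Lemma map_dot (f : {rmorphism L -> L}) a z :
  f (dot a z) = dot (map_mx f a) (map_mx f z).
Proof.
by rewrite !dotE rmorph_sum; apply: eq_bigr => i _; rewrite !mxE rmorphM.
Qed.

End Coordinates.

(** Gaussian elimination: two independent equations fix the coordinates at the pivots [i] and [j],
    so the other two coordinates determine [z]. *)
Lemma two_eqs_coords (L : fieldType) (a b : 'rV[L]_4) : a != 0 ->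
  (forall c, b != c *: a) ->
  exists k l, forall z : 'rV[L]_4, dot a z = 0 -> dot b z = 0 ->
    z 0 k = 0 -> z 0 l = 0 -> z = 0.
Proof.
move=> /rV0Pn[i ai] nab.
(* [d] is [b] with its entry at the pivot [i] cleared; a nonzero entry of [d] is the second
   pivot. *)
pose d := b - (b 0 i / a 0 i) *: a.
have di : d 0 i = 0 by rewrite !mxE divfK ?subrr.
have /rV0Pn[j dj] : d != 0 by rewrite subr_eq0.
have ij : i != j by apply: contraNneq dj => <-; rewrite di.
have : #|~: [set i; j]| == 2.
  by have := cardsC [set i; j]; rewrite cards2 ij card_ord => /(canRL (addKn _)) ->.
move=> /cards2P[k [l [_ kl]]].
exists k, l => z az bz zk zl.
have z0 m : m != i -> m != j -> z 0 m = 0.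
  move=> mi mj; have : m \in ~: [set i; j] by rewrite !inE negb_or mi.
  by rewrite kl !inE => /orP[] /eqP ->.
have zj : z 0 j = 0.
  have : dot d z = 0 by rewrite dotDl -scaleNr dotZl az bz mulr0 addr0.
  rewrite dotE (bigD1 j) //= big1 ?addr0.
    by move/eqP; rewrite mulf_eq0 (negPf dj) => /eqP.
  move=> m mj; have [->|mi] := eqVneq m i; first by rewrite di mul0r.
  by rewrite z0 ?mulr0.
have zi : z 0 i = 0.
  move: az; rewrite dotE (bigD1 i) //= big1 ?addr0.
    by move/eqP; rewrite mulf_eq0 (negPf ai) => /eqP.
  move=> m mi; have [->|mj] := eqVneq m j; first by rewrite zj mulr0.
  by rewrite z0 ?mulr0.
apply/rowP => m; rewrite mxE.
have [->//|mi] := eqVneq m i; have [->//|mj] := eqVneq m j; exact: z0.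
Qed.

Lemma exists_dot_annihilator (L : fieldType) n (M : {vspace 'rV[L]_n}) :
  (\dim M < n)%N ->
  exists2 a : 'rV[L]_n, a != 0 & forall m, m \in M -> dot a m = 0.
Proof.
move=> dM.
pose B : 'M[L]_(n, \dim M) := \matrix_(i, j) (vbasis M)`_j 0 i.
have : kermx B != 0.
  rewrite -mxrank_eq0 mxrank_ker subn_eq0 -ltnNge.
  by apply: leq_ltn_trans dM; apply: rank_leq_col.
move=> /rowV0Pn[a /sub_kermxP aB a0]; exists a => // m /coord_vbasis ->.
rewrite dotC; elim/big_ind: _ => [|x y x0 y0|j _].
- by rewrite dotE big1 // => i _; rewrite mxE mul0r.
- by rewrite dotDl x0 y0 addr0.
rewrite dotZl dotC; suff -> : dot a (vbasis M)`_j = (a *m B) 0 j.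
  by rewrite aB mxE mulr0.
by rewrite dotE mxE; apply: eq_bigr => i _; rewrite mxE.
Qed.

(** * Linear maps over GF(q) on the restriction of scalars *)

Section LinearMaps.

Variables (Fq : finFieldType) (L : fieldExtType Fq) (n : nat).

Definition frob2_base (u : baseVectType 'rV[L]_n) : baseVectType 'rV[L]_n :=
  frob2 (u : 'rV[L]_n).

Fact frob2_base_is_linear : linear frob2_base.
Proof.
move=> a u v; apply/rowP => i; rewrite !mxE mulr_algl.
by rewrite -[LHS]/(frob 2 _) rmorphD /= frobZ mulr_algl.
Qed.
HB.instance Definition _ :=
  GRing.isLinear.Build Fq _ _ _ frob2_base frob2_base_is_linear.

(** For [c = w ^+ 2] this is coordinate [k] of the eigenpart [z]. In general it is linear over [Fq]
    but not over [L], hence the domain [baseVectType]. *)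
Definition eigen_coord (c : L) (k : 'I_n) (u : baseVectType 'rV[L]_n) : L :=
  c * (u : 'rV[L]_n) 0 k + frob 2 ((u : 'rV[L]_n) 0 k).

Fact eigen_coord_is_linear c k : linear (eigen_coord c k).
Proof.
move=> a u v; rewrite /eigen_coord !mxE mulr_algl rmorphD /= frobZ.
by rewrite mulrDr scalerDr scalerAr addrACA.
Qed.
HB.instance Definition _ c k :=
  GRing.isLinear.Build Fq _ _ _ (eigen_coord c k) (eigen_coord_is_linear c k).

End LinearMaps.

(** * The field GF(q^6) for q an odd power of 2 *)

Section EvenSextic.

Variables (h : nat) (Fq : finFieldType) (L : fieldExtType Fq).
Hypotheses (h_odd : odd h) (card_Fq : #|Fq| = (2 ^ h)%N).
Hypothesis dim_L : \dim {:L} = 6%N.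

Local Notation tau := (map_mx (@frob Fq L 1)).
Local Notation sig := (map_mx (@frob Fq L 2)).

Lemma char2_ext : (1 + 1 : L) = 0.
Proof.
have /(pcharf0 (R := L)) // : 2%N \in [pchar L].
by rewrite pchar_lalg; apply: card_finPcharP card_Fq _.
Qed.
Let char2 := char2_ext.

(** As 4 is 1 modulo 3, an odd power of 2 is 2 modulo 3; this is why [tau] squares [w]. *)
Lemma cardFq_mod3 : (#|Fq| %% 3 = 2)%N.
Proof.
rewrite card_Fq -(odd_double_half h) h_odd add1n expnS -muln2 mulnC expnM.
by rewrite mulnC -modnMmr expnAC -modnXm exp1n.
Qed.

Lemma exists_cube_root : exists w : L, w ^+ 2 + w + 1 = 0.
Proof.
apply: (@finField_cube_root (finvect_type L)).
rewrite card_finvect dim_L -subn1 -eqn_mod_dvd; last first.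
  by rewrite expn_gt0 (ltnW (finNzRing_gt1 Fq)).
by rewrite -modnXm cardFq_mod3.
Qed.

Lemma frob6 (x : L) : frob 6 x = x.
Proof. by rewrite -[RHS]frob_dim dim_L. Qed.

Lemma sig3 n (v : 'rV[L]_n) : sig (sig (sig v)) = v.
Proof. by rewrite !map_frob_comp; apply/rowP => i; rewrite !mxE frob6. Qed.

Section CubeRoot.

Variable w : L.
Hypothesis ww : w ^+ 2 + w + 1 = 0.

Lemma cube_root_sqr : w ^+ 2 = w + 1.
Proof. by apply/eqP; rewrite -(oppr2 char2 (w + 1)) -addr_eq0 addrA ww. Qed.
Let w2E := cube_root_sqr.

Lemma cube_root_cube : w ^+ 3 = 1.
Proof.
apply/eqP; rewrite -subr_eq0; apply/eqP.
by transitivity ((w - 1) * (w ^+ 2 + w + 1)); [ring | rewrite ww mulr0].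
Qed.
Let w3E := cube_root_cube.

Lemma cube_root_neq0 : w != 0.
Proof.
by apply/eqP => w0; move: w3E; rewrite w0 expr0n => /esym/eqP; rewrite oner_eq0.
Qed.
Let w0 := cube_root_neq0.

Lemma frob1_cube_root : frob 1 w = w ^+ 2.
Proof.
rewrite /frob expn1 (divn_eq #|Fq| 3) cardFq_mod3 exprD mulnC exprM w3E.
by rewrite expr1n mul1r.
Qed.
Let frob1w := frob1_cube_root.

Lemma frob2_cube_root : frob 2 w = w.
Proof.
rewrite -[2%N]/(1 + 1)%N -frob_comp frob1w rmorphXn /= frob1w -exprM.
by rewrite (exprD w 3 1) w3E mul1r.
Qed.
Let frob2w := frob2_cube_root.

Lemma tau_Umx : map_mx (frob 1) (Umx w) = Umx (w ^+ 2).
Proof. by rewrite map_Umx -frob1w. Qed.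

Lemma tau_Umx2 : map_mx (frob 1) (Umx (w ^+ 2)) = Umx w.
Proof. by rewrite -tau_Umx map_Umx map_Umx /= frob_comp frob2w. Qed.

(** * Semilinear eigenvectors of Q and of its transpose *)

Lemma Fq_not_eigen A (v : 'rV[L]_4) k :
  Phi5 A = 0 -> v *m A = k *: v -> frob 1 k = k -> v = 0.
Proof.
move=> A0 vA kq; apply/eqP; apply: contraT => v0.
have := Phi5_eigen A0 vA v0; move/eqP.
rewrite (negPf (Phi5_no_root_Fq char2 h_odd _)) //.
by rewrite -card_Fq -[#|Fq|]expn1.
Qed.

(** Applying [sig] to the second equation gives [frob 2 c = w * c], which makes
    [w ^+ 2 * (frob 1 c * c)] invariant under [frob 1]; iterating the equation makes it an
    eigenvalue of [UUmx w]. *)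
Lemma eigen_semilinear (z : 'rV[L]_4) c :
  sig z = w *: z -> tau z *m Umx w = c *: z -> z = 0.
Proof.
move=> sz tz; apply/eqP; apply: contraT => z0.
have c2 : frob 2 c = w * c.
  have /eqP : (frob 2 c * w) *: z = (w ^+ 2 * c) *: z.
    have := congr1 sig tz; rewrite map_mxM map_mxZ /= sz scalerA => <-.
    rewrite map_frob_comp -[(2 + 1)%N]/(1 + 2)%N -map_frob_comp sz map_mxZ /=.
    by rewrite map_Umx /= frob2w frob1w -scalemxAl tz scalerA.
  rewrite -subr_eq0 -scalerBl scaler_eq0 (negPf z0) orbF subr_eq0 => /eqP.
  by move=> e; apply: (mulIf w0); rewrite e; ring.
have kq : frob 1 (w ^+ 2 * (frob 1 c * c)) = w ^+ 2 * (frob 1 c * c).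
  rewrite rmorphM (rmorphXn (frob 1) 2 w) rmorphM /= frob_comp c2 frob1w.
  by transitivity (w ^+ 3 * (w ^+ 2 * (frob 1 c * c)));
    [ring | rewrite w3E mul1r].
have wzU : w *: (z *m UUmx w) = (frob 1 c * c) *: z.
  have := congr1 tau tz; rewrite map_mxM map_mxZ /= map_frob_comp sz tau_Umx.
  move/(congr1 (mulmx^~ (Umx w))).
  by rewrite -!scalemxAl tz scalerA -mulmxA.
have zU : z *m UUmx w = (w ^+ 2 * (frob 1 c * c)) *: z.
  by rewrite -scalerA -wzU scalerA -exprSr w3E scale1r.
by rewrite (Fq_not_eigen (Phi5_UUmx char2 ww) zU kq) eqxx in z0.
Qed.

(** The same argument for the transpose; here sigma fixes both [a] and [c], and the eigenvalue in
    GF(q) is [frob 1 c * c]. *)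
Lemma dual_not_semilinear (a : 'rV[L]_4) c :
  sig a = a -> tau a *m (Umx (w ^+ 2))^T = c *: a -> a = 0.
Proof.
move=> sa ta; apply/eqP; apply: contraT => a0.
have c2 : frob 2 c = c.
  have /eqP : frob 2 c *: a = c *: a.
    have := congr1 sig ta; rewrite map_mxM map_mxZ /= sa => <-.
    rewrite map_frob_comp -[(2 + 1)%N]/(1 + 2)%N -map_frob_comp sa -map_trmx.
    by rewrite map_Umx rmorphXn /= frob2w.
  by rewrite -subr_eq0 -scalerBl scaler_eq0 (negPf a0) orbF subr_eq0 => /eqP.
have kq : frob 1 (frob 1 c * c) = frob 1 c * c.
  by rewrite rmorphM /= frob_comp c2 mulrC.
have aU : a *m (UUmx w)^T = (frob 1 c * c) *: a.
  have := congr1 tau ta; rewrite map_mxM map_mxZ /= map_frob_comp sa -map_trmx.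
  rewrite tau_Umx2 => /(congr1 (mulmx^~ (Umx (w ^+ 2))^T)).
  by rewrite -scalemxAl ta scalerA -mulmxA -trmx_mul.
by rewrite (Fq_not_eigen (Phi5_tr (Phi5_UUmx char2 ww)) aU kq) eqxx in a0.
Qed.

(** * Eigenparts of the elements of U *)

Lemma U_coords (u : 'rV[L]_4) : (u : baseVectType 'rV[L]_4) \in U L ->
  exists x y : L, [/\ frob 4 x = x + frob 2 x, frob 4 y = y + frob 2 y &
    u = \row_(j < 4) [:: x; y; frob 2 x + frob 1 y; frob 1 x + frob 3 y]`_j].
Proof.
move=> /mem_U[x [y [Tx Ty ->]]]; exists x, y.
have Tr0 (t : L) : Tr t = 0 -> frob 4 t = t + frob 2 t.
  move=> Tt; apply/eqP; rewrite -(oppr2 char2 (_ + _)) -addr_eq0 addrC.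
  exact/eqP.
split; [exact: Tr0 | exact: Tr0 |].
by apply/rowP => j; rewrite !mxE.
Qed.

(** Each coordinate of [u] is a sum of Frobenius conjugates of [x] and [y], so it has trace zero as
    they do; signs vanish in characteristic 2. *)
Lemma U_sig2 (u : 'rV[L]_4) : (u : baseVectType 'rV[L]_4) \in U L ->
  sig (sig u) = u + sig u.
Proof.
move=> /U_coords[x [y [x4 y4 ->]]].
have frob4 k (t : L) : frob 4 t = t + frob 2 t ->
    frob (k + 4) t = frob k t + frob (k + 2) t.
  by move=> t4; rewrite -!frob_comp t4 rmorphD.
apply/rowP => j; rewrite !mxE frob_comp.
case: j => [[|[|[|[|//]]]] ?] //=; rewrite !rmorphD /= !frob_comp.
  by rewrite (frob4 2%N x x4) (frob4 1%N y y4) addrACA.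
by rewrite (frob4 1%N x x4) (frob4 3%N y y4) addrACA.
Qed.

(** Once the trace conditions have removed [frob 4] and [frob 5], and [frob 6] is the identity, each
    coordinate is a linear identity over GF(4) in the remaining conjugates of [x] and [y]. *)
Lemma U_eigenparts (u : 'rV[L]_4) : (u : baseVectType 'rV[L]_4) \in U L ->
  w *: u + sig u = tau (w ^+ 2 *: u + sig u) *m Umx w.
Proof.
move=> /U_coords[x [y [x4 y4 ->]]].
have frob5 (t : L) : frob 4 t = t + frob 2 t -> frob 5 t = frob 1 t + frob 3 t.
  by move=> t4; rewrite -[5%N]/(1 + 4)%N -frob_comp t4 rmorphD /= frob_comp.
have x5 := frob5 x x4; have y5 := frob5 y y4.
(* The identity holds modulo 2 and w ^+ 2 + w + 1; s and t are the cofactors. *)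
have eq_mod (a b s t : L) : a - b = (1 + 1) * s + (w ^+ 2 + w + 1) * t -> a = b.
  by rewrite char2 ww !mul0r addr0 => /eqP; rewrite subr_eq0 => /eqP.
have wE : w ^+ 2 = 1 + w by rewrite addrC.
have fw2 : frob 1 (w ^+ 2) = w by rewrite -frob1w frob_comp.
rewrite map_mxD map_mxZ /= fw2 map_frob_comp.
apply/rowP => j; rewrite !mxE !big_ord_recl big_ord0 !mxE /= !rmorphD /=.
rewrite !frob_comp wE !frob6 x4 y4 x5.
set x1 := frob 1 x; set x2 := frob 2 x; set x3 := frob 3 x.
set y1 := frob 1 y; set y2 := frob 2 y; set y3 := frob 3 y.
case: j => [[|[|[|[|//]]]] ?] //=;
  rewrite ?rmorphD /= ?frob_comp ?x4 ?y4 ?x5 ?y5 -/x1 -/x2 -/x3 -/y1 -/y2 -/y3.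
- by apply: (eq_mod _ _ (x2 - (1 + w) * x3) (- x2 - x1 - y2 - y)); ring.
- by apply: (eq_mod _ _ (y2 - w * x1) (- y2 - x3)); ring.
- by apply: (eq_mod _ _ (- w * x3 - w * y2 - (1 + w) * y) (- x1 - x3 - y2)); ring.
- by apply: (eq_mod _ _ y1 (- y1)); ring.
Qed.

Lemma U_eigenpart_sig (u : 'rV[L]_4) : (u : baseVectType 'rV[L]_4) \in U L ->
  sig (w ^+ 2 *: u + sig u) = w *: (w ^+ 2 *: u + sig u).
Proof.
move=> /U_sig2 su; rewrite map_mxD map_mxZ su rmorphXn /= frob2w.
rewrite scalerDr scalerA -exprS w3E scale1r w2E scalerDl scale1r.
have s0 (s : 'rV[L]_4) : s + s = 0 by apply/rowP => i; rewrite !mxE addrr2.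
by rewrite addrACA s0 addr0 addrC.
Qed.

Lemma eigenparts_sum (u : 'rV[L]_4) :
  u = (w ^+ 2 *: u + sig u) + (w *: u + sig u).
Proof.
apply/rowP => i; rewrite !mxE addrACA (addrr2 char2) addr0 -mulrDl w2E.
by rewrite addrAC (addrr2 char2) add0r mul1r.
Qed.

(** [u] is recovered from its eigenpart [z] as [z + tau z *m Umx w]. *)
Lemma U_eigenpart_eq0 (u : 'rV[L]_4) : (u : baseVectType 'rV[L]_4) \in U L ->
  w ^+ 2 *: u + sig u = 0 -> u = 0.
Proof.
move=> uU z0; rewrite (eigenparts_sum u) (U_eigenparts uU) z0.
by rewrite map_mx0 mul0mx addr0.
Qed.

(** The second equation comes from [dot a (tau z *m Umx w) = 0] by applying [tau], which turns
    [tau z] into [sig z = w *: z], and moving the matrix to the other side. *)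
Lemma U_dot_eigenpart (a u : 'rV[L]_4) :
  sig a = a -> (u : baseVectType 'rV[L]_4) \in U L -> dot a u = 0 ->
  dot a (w ^+ 2 *: u + sig u) = 0 /\
  dot (tau a *m (Umx (w ^+ 2))^T) (w ^+ 2 *: u + sig u) = 0.
Proof.
move=> sa uU au.
have asu : dot a (sig u) = 0 by rewrite -sa -map_dot au rmorph0.
have dot_comb c : dot a (c *: u + sig u) = 0.
  by rewrite dotC dotDl dotZl dotC au dotC asu mulr0 addr0.
split=> //; have := dot_comb w; rewrite (U_eigenparts uU).
move/(congr1 (frob 1)); rewrite rmorph0 map_dot map_mxM /= tau_Umx.
rewrite map_frob_comp (U_eigenpart_sig uU) -scalemxAl dotC dotZl dotC => /eqP.
by rewrite mulf_eq0 (negPf w0) /= dot_mulmx trmxK => /eqP.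
Qed.

(** Both eigenparts are multiples of [u]. Unless [z] is already zero, [tau z *m Umx w] is then a
    multiple of [z], and [eigen_semilinear] applies. *)
Lemma U_no_fixed_point (u : 'rV[L]_4) l :
  (u : baseVectType 'rV[L]_4) \in U L -> sig u = l *: u -> u = 0.
Proof.
move=> uU su; have := U_eigenparts uU; have := U_eigenpart_sig uU.
rewrite su -!scalerDl; set z := (_ *: u) => sz tz.
have z0 : z = 0.
  have [wl|wl] := eqVneq (w ^+ 2 + l) 0; first by rewrite /z wl scale0r.
  apply: (eigen_semilinear (c := (w + l) / (w ^+ 2 + l)) sz).
  by rewrite -tz scalerA divfK.
by apply: (U_eigenpart_eq0 uU); rewrite su -scalerDl.
Qed.

(** * Hyperplanes fixed by sigma *)

Lemma rational_annihilator (M : {vspace 'rV[L]_4}) :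
  \dim M = 3%N -> frob2_fixed M ->
  exists a : 'rV[L]_4,
    [/\ a != 0, sig a = a & forall m, m \in M -> dot a m = 0].
Proof.
move=> dM fM; have [|a a0 aM] := @exists_dot_annihilator L 4 M.
  by rewrite dM.
(* As [M] is fixed, the conjugates of an annihilator annihilate [M], and so does its trace, which is
   fixed by sigma. *)
have annS (b : 'rV[L]_4) : (forall m, m \in M -> dot b m = 0) ->
    forall m, m \in M -> dot (sig b) m = 0.
  move=> bM m /fM[m' m'M ->]; rewrite -[frob2 m']/(sig m').
  by rewrite -map_dot bM // rmorph0.
have /rV0Pn[i ai] := a0; pose b := (a 0 i)^-1 *: a.
have bM m : m \in M -> dot b m = 0 by move=> mM; rewrite dotZl aM ?mulr0.
(* The i-th coordinate of the trace of b is 1 + 1 + 1 = 1. *)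
exists (b + sig b + sig (sig b)); split.
- apply/rV0Pn; exists i; rewrite !mxE mulVf // !rmorph1.
  by rewrite char2 add0r oner_eq0.
- by rewrite !map_mxD sig3 addrC addrA.
- by move=> m mM; rewrite !dotDl bM ?annS ?addr0 //; exact: annS.
Qed.

(** The hyperplane imposes on [z] two independent equations, [a] and [b], so two coordinates of [z]
    determine it and hence [u]. Each coordinate lies in an eigenspace of sigma on [L], of dimension
    at most 2 over GF(q). *)
Lemma dim_fixed_cap_U (M : {vspace 'rV[L]_4}) :
  \dim M = 3%N -> frob2_fixed M -> (\dim (restrVspace M :&: U L) <= 4)%N.
Proof.
move=> dM fM; have [a [a0 sa aM]] := rational_annihilator dM fM.
pose b := tau a *m (Umx (w ^+ 2))^T.
have nab c : b != c *: a.
  by apply: contraNneq a0 => /dual_not_semilinear ->.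
have [k [l zkl]] := two_eqs_coords a0 nab.
pose A := (restrVspace M :&: U L)%VS.
have memA u : u \in A -> ((u : 'rV[L]_4) \in M) /\ u \in U L.
  by rewrite memv_cap mem_restrVspace => /andP.
pose f i := linfun (@eigen_coord Fq L 4 (w ^+ 2) i).
have fE i u : f i u = eigen_coord (w ^+ 2) i u by rewrite lfunE.
have dimf i (B : {vspace baseVectType 'rV[L]_4}) : (B <= A)%VS ->
    (\dim (f i @: B) <= 2)%N.
  move=> BA; apply: (@dim_frob_eigen _ _ 2 w) => // x /memv_imgP[u uB ->].
  have [_ uU] := memA u (subvP BA _ uB).
  have := congr1 (fun v : 'rV[L]_4 => v 0 i) (U_eigenpart_sig uU).
  by rewrite !mxE fE.
have A0 : (A :&: lker (f k) :&: lker (f l) = 0)%VS.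
  apply/eqP; rewrite -subv0; apply/subvP => u; rewrite memv0.
  move=> /memv_capP[/memv_capP[/memA[uM uU]]]; rewrite !memv_ker !fE.
  move=> /eqP uk /eqP ul; apply/eqP.
  have [az bz] := U_dot_eigenpart sa uU (aM _ uM).
  by apply: (U_eigenpart_eq0 uU); apply: zkl => //; rewrite !mxE.
rewrite -/A -(limg_ker_dim (f k) A) -(limg_ker_dim (f l) (A :&: lker (f k))).
by rewrite A0 dimv0 add0n (leq_add (dimf l _ (capvSl _ _)) (dimf k _ _)).
Qed.

End CubeRoot.
End EvenSextic.

(** * Planes fixed by sigma, and the theorem *)

Lemma U_frob2 (Fq : finFieldType) (L : fieldExtType Fq) (u : 'rV[L]_4) :
  (u : baseVectType 'rV[L]_4) \in U L ->
  (frob2 u : baseVectType 'rV[L]_4) \in U L.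
Proof.
have Tr_frob (t : L) : Tr t = 0 -> Tr (frob 2 t) = 0.
  move=> Tt; rewrite -[RHS](rmorph0 (frob 2)) -Tt.
  rewrite -[Tr t]/(t + frob 2 t + frob 4 t).
  rewrite -[Tr _]/(frob 2 t + frob 2 (frob 2 t) + frob 4 (frob 2 t)).
  by rewrite !rmorphD /= !frob_comp.
move=> /mem_U[x [y [Tx Ty ->]]]; apply/mem_U; exists (frob 2 x), (frob 2 y).
split; [exact: Tr_frob | exact: Tr_frob |].
have row x' y' : Uvec x' y' =
    \row_(j < 4) [:: x'; y'; frob 2 x' + frob 1 y'; frob 1 x' + frob 3 y']`_j.
  by [].
rewrite !row; apply/rowP => j; rewrite !mxE -[LHS]/(frob 2 _).
by case: j => [[|[|[|[|//]]]] ?] //=; rewrite rmorphD /= !frob_comp.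
Qed.

(** [u] and [frob2 u] form a basis of [W], and the relation for [frob2 (frob2 u)] makes their span
    stable; order 3 then gives surjectivity. *)
Lemma frob2_fixed_plane (Fq : finFieldType) (L : fieldExtType Fq) n
    (W : {vspace 'rV[L]_n}) (u : 'rV[L]_n) :
  (forall v : 'rV[L]_n, frob2 (frob2 (frob2 v)) = v) ->
  \dim W = 2%N -> u != 0 -> u \in W -> frob2 u \in W ->
  frob2 (frob2 u) = u + frob2 u -> frob2 u \notin <[u]>%VS -> frob2_fixed W.
Proof.
move=> frob23 dW u0 uW suW ssu nsu.
have WE : W = (<[u]> + <[frob2 u]>)%VS.
  apply/esym/eqP; rewrite eqEdim subv_add -!memvE uW suW /= dW ltnNge.
  apply: contra nsu => d1; suff -> : <[u]>%VS = (<[u]> + <[frob2 u]>)%VS.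
    by rewrite memvE addvSr.
  by apply/eqP; rewrite eqEdim addvSl dim_vline u0.
have frob2D (v v' : 'rV[L]_n) : frob2 (v + v') = frob2 v + frob2 v'.
  exact: (map_mxD (frob 2)).
have frob2Z a (v : 'rV[L]_n) : frob2 (a *: v) = frob 2 a *: frob2 v.
  exact: (map_mxZ (frob 2)).
have fW v : v \in W -> frob2 v \in W.
  rewrite {1}WE => /memv_addP[_ /vlineP[a ->] [_ /vlineP[b ->] ->]].
  by rewrite frob2D !frob2Z ssu memvD ?memvZ ?memvD.
move=> v; split=> [[m mW ->]|vW]; first exact: fW.
by exists (frob2 (frob2 v)); [apply/fW/fW | rewrite frob23].
Qed.

Theorem theorem2p4 (h : nat) (Fq : finFieldType) (L : fieldExtType Fq)
  (h_odd : odd h) (card_Fq : #|Fq| = (2 ^ h)%N) (dim_L : \dim {:L} = 6%N)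
  (W M : {vspace 'rV[L]_4})
  (dimW : \dim W = 2%N) (W_not_fixed : ~ frob2_fixed W)
  (dimM : \dim M = 3%N) (M_fixed : frob2_fixed M) (W_sub_M : (W <= M)%VS) :
  (\dim (restrVspace W :&: U L) <= 2)%N.
Proof.
have [w ww] := exists_cube_root h_odd card_Fq dim_L.
have dMU := dim_fixed_cap_U h_odd card_Fq dim_L ww dimM M_fixed.
set S := (restrVspace W :&: U L)%VS; rewrite leqNgt; apply/negP => dS.
have frob23 (v : 'rV[L]_4) : frob2 (frob2 (frob2 v)) = v.
  exact: (sig3 dim_L).
have memS u : u \in S -> ((u : 'rV[L]_4) \in W) /\ u \in U L.
  by rewrite memv_cap mem_restrVspace => /andP.
pose s := linfun (@frob2_base Fq L 4).
have sE u : s u = frob2 (u : 'rV[L]_4) by rewrite lfunE.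
have s_inj : (S :&: lker s = 0)%VS.
  apply/eqP; rewrite -subv0; apply/subvP => u.
  rewrite memv_cap memv_ker sE memv0 => /andP[_ /eqP u0].
  have f0 : frob2 (0 : 'rV[L]_4) = 0 by apply: (map_mx0 (frob 2)).
  by rewrite -[u]frob23 u0 !f0.
have sS : (s @: S <= restrVspace M :&: U L)%VS.
  apply/subvP => _ /memv_imgP[u /memS[uW uU] ->].
  rewrite sE memv_cap U_frob2 // mem_restrVspace andbT.
  by apply/M_fixed; exists (u : 'rV[L]_4); rewrite ?(subvP W_sub_M).
have SM : (S <= restrVspace M :&: U L)%VS.
  apply/subvP => u /memS[uW uU]; rewrite memv_cap uU mem_restrVspace.
  by rewrite (subvP W_sub_M _ uW).
(* Otherwise [S] and its image, of equal dimension at least 3, would be in direct sum inside a space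
   of dimension at most 4. *)
have : (S :&: s @: S)%VS != 0%VS.
  apply: contraTneq dS => SS0; rewrite -leqNgt.
  have := dimv_sum_cap S (s @: S); rewrite SS0 dimv0 addn0 limg_dim_eq // => dSS.
  have : (\dim S + \dim S <= 4)%N.
    by rewrite -dSS (leq_trans _ dMU) // dimvS // subv_add SM sS.
  by rewrite addnn -[4%N]/(2.*2)%N leq_double.
rewrite -vpick0; set v := vpick _ => v0.
have : v \in (S :&: s @: S)%VS := memv_pick _.
rewrite memv_cap => /andP[/memS[vW _] /memv_imgP[u /memS[uW uU] vE]].
rewrite sE in vE.
have u0 : (u : 'rV[L]_4) != 0.
  apply: contraNneq v0 => u0; rewrite vE u0.
  by apply/eqP; exact: (map_mx0 (frob 2)).
apply: W_not_fixed; apply: (frob2_fixed_plane frob23 dimW u0 uW).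
- by rewrite -vE.
- exact: (U_sig2 card_Fq uU).
(* If [frob2 u] were a multiple of [u], then [u] would span a sigma-fixed point. *)
apply/negP => /vlineP[l lE]; move/eqP: u0; apply.
exact: (U_no_fixed_point h_odd card_Fq dim_L ww uU lE).
Qed.
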